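(* Let $\sigma=\sum_{j=1}^m q_j\delta_{y_j}$ with $y_1<\dots<y_m$, $q_j>0$, $\sum_{j=1}^m q_j=1$, and $\mu=\sum_{i=1}^n p_i\delta_{x_i}$ with $x_1<\dots<x_n$, $p_i>0$, $\sum_{i=1}^n p_i=1$, be probability measures on $\mathbb{R}$. Let $a\in\mathbb{R}$ and let $\mu_a=(\tau_a)_\#\mu$, where $\tau_a(x)=x+a$. Then the discrete cumulative distribution transforms of $\mu_a$ and $\mu$ relative to $\sigma$ satisfy $$T_{\mu_a}(y_j)=T_\mu(y_j)+a,\qquad j=1,\dots,m.$$ Equivalently, $T_{\mu_a}=T_\mu+a$ pointwise on the support of $\sigma$.
   Context: For a Borel probability measure $\mu$ on $\mathbb{R}$, $F_\mu(x)=\mu((-\infty,x])$ is its cumulative distribution function, and its generalized inverse is $F_\mu^{-1}(s)=\inf\{x\in\mathbb{R}: F_\mu(x)\ge s\}$ for $s\in(0,1]$. The discrete cumulative distribution transform (CDT) of an atomic probability measure $\mu$ relative to $\sigma$ is the map $T_\mu=F_\mu^{-1}\circ F_\sigma$, determined by its values on the support $\{y_1,\dots,y_m\}$ of $\sigma$. The pushforward is $(T_\#\mu)(A)=\mu(T^{-1}(A))$ for Borel sets $A$. $\delta_x$ is the Dirac mass at $x$. *)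

(* Defs.v *)
From HB Require Import structures.
From mathcomp Require Import all_boot all_order all_algebra.
From mathcomp Require Import all_classical all_reals all_analysis.
From mathcomp Require Import measurable_realfun.

Set Implicit Arguments.
Unset Strict Implicit.
Unset Printing Implicit Defensive.

Import Order.TTheory GRing.Theory Num.Theory.
Import numFieldNormedType.Exports.

Local Open Scope classical_set_scope.
Local Open Scope ring_scope.

(* The measurable structure of R : realType is the Borel sigma-algebra. *)
Notation borel_probability R := (probability R R).

(* The library's [cdf] takes a random variable; this is its real-valued
   counterpart for a measure. *)
Definition cdf_of (R : realType) (mu : borel_probability R) (x : R) : R :=
  fine (mu `]-oo, x]%classic).

(* To be used for 0 < s <= 1. For a finitely supported mu, the set is then
   nonempty and bounded below, so that [inf] is the true infimum. (For an
   arbitrary mu it may be empty at s = 1, where [inf] is 0 by convention.) *)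
Definition cdf_inv (R : realType) (mu : borel_probability R) (s : R) : R :=
  inf [set x : R | s <= cdf_of mu x].

Definition cdt (R : realType) (sigma mu : borel_probability R) : R -> R :=
  cdf_inv mu \o cdf_of sigma.

Definition measure_support (R : realType) (mu : borel_probability R) : set R :=
  [set x : R | forall U : set R, open U -> U x -> (0 < mu U)%E].

Definition tau (R : realType) (a : R) : R -> R := fun x => x + a.

Lemma measurable_tau (R : realType) (a : R) :
  measurable_fun [set: R] (tau a).
Proof.
exact: (measurable_funD (@measurable_id _ _ setT) (measurable_cst a)).
Qed.

HB.instance Definition _ (R : realType) (a : R) :=
  isMeasurableFun.Build _ _ _ _ (tau a) (measurable_tau a).

(* The library's [distribution P X] is the pushforward of P by X, as a
   probability measure. *)
Definition translate (R : realType) (mu : borel_probability R) (a : R) :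
  borel_probability R := distribution mu (tau a).

(* Main.v *)
(* Since F_{mu_a}(x) = F_mu(x - a), the superlevel sets of F_{mu_a} are those
   of F_mu translated by a, and so are their infima. The levels that occur,
   F_sigma(y_j), lie in (0, 1], where these sets are nonempty and bounded
   below, so that the infima are not junk values. *)
Require Import Defs.
From HB Require Import structures.
From mathcomp Require Import all_boot all_order all_algebra.
From mathcomp Require Import all_classical all_reals all_analysis.
From mathcomp Require Import measurable_realfun.

Set Implicit Arguments.
Unset Strict Implicit.
Unset Printing Implicit Defensive.

Import Order.TTheory GRing.Theory Num.Theory.
Import numFieldNormedType.Exports.

Local Open Scope classical_set_scope.
Local Open Scope ring_scope.

Lemma cdf_of_translate (R : realType) (mu : borel_probability R) (a x : R) :
  cdf_of (translate mu a) x = cdf_of mu (x - a).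
Proof.
rewrite /cdf_of /translate /distribution /pushforward; congr (fine (mu _)).
by apply/seteqP; split => z /=; rewrite /tau !in_itv/= lerBrDr.
Qed.

Lemma cdf_inv_translate (R : realType) (mu : borel_probability R) (a s : R) :
  has_inf [set x : R | s <= cdf_of mu x] ->
  cdf_inv (translate mu a) s = cdf_inv mu s + a.
Proof.
(* Writing [a] as the infimum of the singleton [[set a]] turns the translation into a Minkowski sum,
   over which [inf] is additive once both sets have an infimum; this is where [infS] enters. *)
move=> infS; rewrite /cdf_inv -[X in _ = _ + X]inf1 -(inf_sumE infS (has_inf1 a)).
congr inf; apply/seteqP; split => z /=; rewrite cdf_of_translate.
  by move=> sz; exists (z - a) => //; exists a => //; rewrite subrK.
by move=> [u su [_ -> <-]]; rewrite addrK.
Qed.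

Lemma cdf_of_le1 (R : realType) (mu : borel_probability R) (x : R) :
  cdf_of mu x <= 1.
Proof.
rewrite -lee_fin /cdf_of fineK ?fin_num_measure//.
exact: probability_le1.
Qed.

Section finitely_supported.
Context (R : realType) (n : nat) (p x : 'I_n -> R) (mu : borel_probability R).
Hypothesis p_gt0 : forall i : 'I_n, 0 < p i.
Hypothesis muE : forall A : set (R), measurable A ->
  mu A = (\sum_(i < n) (p i)%:E * \d_(x i) A)%E.

Lemma atomic_eq0 (A : set R) : measurable A ->
  (forall i, ~ A (x i)) -> mu A = 0%E.
Proof.
move=> mA xA; rewrite muE// big1// => i _.
by rewrite diracE (memNset (xA i)) mule0.
Qed.

Lemma atomic_gt0 (A : set R) (i : 'I_n) : measurable A -> A (x i) ->
  (0 < mu A)%E.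
Proof.
move=> mA Axi; rewrite muE// (bigD1 i)//= diracE mem_set// mule1.
apply: (@lt_le_trans _ _ (p i)%:E); first by rewrite lte_fin.
rewrite leeDl// sume_ge0// => k _.
by rewrite mule_ge0// lee_fin ltW.
Qed.

(** The atom itself lies in the closed half-line ending at it. Applied to [sigma], this keeps the
    levels at which [cdf_inv] is evaluated away from 0. *)
Lemma cdf_of_atom_gt0 (i : 'I_n) : 0 < cdf_of mu (x i).
Proof.
rewrite -lte_fin /cdf_of fineK ?fin_num_measure//.
by apply: (@atomic_gt0 _ i) => //=; rewrite in_itv/= lexx.
Qed.

(** The finite set of atoms is closed, so its complement is an open null set; a point outside the
    atoms thus has a null neighbourhood. *)
Lemma measure_support_atomic (t : R) :
  measure_support mu t -> exists i, x i = t.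
Proof.
move=> supp_t; apply: contrapT => /forallNP xt.
have cl : closed (range x).
  exact: (compact_closed (@Rhausdorff R) (finite_compact (finite_image _ (@finite_finset _ _)))).
have oU : open (~` range x) by exact: closed_openC.
have xU i : ~ (~` range x) (x i) by apply; exists i.
have tU : (~` range x) t by move=> [i _]; exact: xt.
have := supp_t _ oU tU.
by rewrite atomic_eq0 ?ltxx//; exact: open_measurable.
Qed.

(** All atoms lie in a bounded interval. To its right the cdf is 1, so [s <= 1] gives a point of the
    set; to its left the cdf is 0, so [0 < s] gives a lower bound. *)
Lemma has_inf_cdf_of_ge (s : R) : 0 < s <= 1 ->
  has_inf [set z : R | s <= cdf_of mu z].
Proof.
(* The sum of the [|x i|] serves as a common bound for all of them. *)
move=> /andP[s_gt0 s_le1]; pose M : R := \sum_(i < n) `|x i|.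
have leM i : `|x i| <= M by rewrite /M (bigD1 i)//= lerDl sumr_ge0.
split.
  exists M => /=; suff -> : cdf_of mu M = 1 by [].
  (* The value 1 is obtained from the complement, which contains no atom and so is null. *)
  rewrite /cdf_of -(setCK `]-oo, M]%classic) probability_setC; last exact: measurableC.
  rewrite atomic_eq0 ?sube0//; first exact: measurableC.
  by move=> i /=; apply; rewrite in_itv/= (le_trans (ler_norm _)).
exists (- M) => z /=; apply: contraTT; rewrite -!ltNge => zM.
suff -> : cdf_of mu z = 0 by [].
rewrite /cdf_of atomic_eq0// => i /=; rewrite in_itv/= => xz.
have := lt_le_trans zM (lerNnormlW (leM i)).
by rewrite ltNge xz.
Qed.

End finitely_supported.

Theorem proposition5p1 (R : realType) (m n : nat)
  (q y : 'I_m -> R) (p x : 'I_n -> R)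
  (sigma mu : borel_probability R) (a : R)
  (y_incr : forall i j : 'I_m, (i < j)%N -> y i < y j)
  (q_gt0 : forall j : 'I_m, 0 < q j)
  (q_sum1 : \sum_(j < m) q j = 1)
  (sigmaE : forall A : set (R), measurable A ->
    sigma A = (\sum_(j < m) (q j)%:E * \d_(y j) A)%E)
  (x_incr : forall i j : 'I_n, (i < j)%N -> x i < x j)
  (p_gt0 : forall i : 'I_n, 0 < p i)
  (p_sum1 : \sum_(i < n) p i = 1)
  (muE : forall A : set (R), measurable A ->
    mu A = (\sum_(i < n) (p i)%:E * \d_(x i) A)%E) :
  (forall j : 'I_m, cdt sigma (translate mu a) (y j) = cdt sigma mu (y j) + a) /\
  (forall t : R, measure_support sigma t ->
    cdt sigma (translate mu a) t = cdt sigma mu t + a).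
Proof.
have cdtD j : cdt sigma (translate mu a) (y j) = cdt sigma mu (y j) + a.
  (* The level is [cdf_of sigma (y j)]: the atoms of [sigma] place it in (0, 1], those of [mu] then
     provide the infimum. *)
  apply: cdf_inv_translate; apply: (has_inf_cdf_of_ge muE).
  by rewrite (cdf_of_atom_gt0 q_gt0 sigmaE) cdf_of_le1.
(* A support point of [sigma] is some [y j], which reduces the second claim to the first. *)
by split=> // t /(measure_support_atomic sigmaE)[j <-].
Qed.
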